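(* Let $d\ge2$, $N\ge1$, and let $\psi_1,\ldots,\psi_N,\psi$ be $N+1$ unit vectors in $\mathbb{C}^d$ such that any two distinct members of this family have inner product of modulus $\frac1{\sqrt d}$. For $p\in[0,1]$ let $$\rho(p)=\frac pN\sum_{i=1}^N|\psi_i\rangle\langle\psi_i|\otimes|\psi_i\rangle\langle\psi_i|+(1-p)\,|\psi\rangle\langle\psi|\otimes|\psi\rangle\langle\psi|.$$ Then the family $\rho(p)$, $p\in[\frac N{N+1},1]$, traces the lower boundary of the separable set between the kinks at $\tilde{\mathcal{R}}^{(2)}[\rho(\tfrac{N}{N+1})]=\frac1{N+1}$ and $\tilde{\mathcal{R}}^{(2)}[\rho(1)]=\frac1N$; that is, these two equalities hold and $$\Big\{\big(\tilde{\mathcal{R}}^{(2)}[\rho(p)],\tilde{\mathcal{R}}^{(4)}[\rho(p)]\big):\ \tfrac N{N+1}\le p\le1\Big\}=\Big\{(x,f_{\mathrm{lb}}(x)):\ \tfrac1{N+1}\le x\le\tfrac1N\Big\}.$$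
   Context: Correlation matrix: fix Hermitian $d\times d$ matrices $\lambda_0=\mathbb{1},\lambda_1,\ldots,\lambda_{d^2-1}$ with $\mathrm{Tr}(\lambda_i\lambda_j)=d\,\delta_{ij}$. For a density matrix $\rho$ on $\mathbb{C}^d\otimes\mathbb{C}^d$, its correlation matrix is the real $(d^2-1)\times(d^2-1)$ matrix $T$ with $T_{ij}=\mathrm{Tr}(\rho\,\lambda_i\otimes\lambda_j)$, $1\le i,j\le d^2-1$. Normalized second and fourth moments (independent of the chosen basis): $$\tilde{\mathcal{R}}^{(2)}(\rho)=\frac{\mathrm{Tr}(TT^\dagger)}{(d-1)^2},\qquad \tilde{\mathcal{R}}^{(4)}(\rho)=\frac{2\,\mathrm{Tr}(TT^\dagger TT^\dagger)+\mathrm{Tr}(TT^\dagger)^2}{3(d-1)^4}.$$ Lower boundary: the boundary of the separable set referred to is the graph of the function $f_{\mathrm{lb}}$, where $f_{\mathrm{lb}}(x)$ is the minimum of $\tilde{\mathcal R}^{(4)}$ at fixed $\tilde{\mathcal R}^{(2)}=x$ over nonnegative singular values of $T$ subject to $\|T\|_{\mathrm{Tr}}\le d-1$ (a constraint satisfied by all separable states). For $\frac1{K+1}\le x\le\frac1K$ with $1\le K\le d^2-2$ it is given by $$f_{\mathrm{lb}}(x)=\frac13x^2+\frac{2}{3(K+1)^4}\left[\big(\sqrt{v}-1\big)^4+\frac{\big(\sqrt{v}+K\big)^4}{K^3}\right],\qquad v=K(K+1)\Big(x-\frac1{K+1}\Big).$$ The kinks are the points $(\frac1K,f_{\mathrm{lb}}(\frac1K))$,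 $K=1,\ldots,d^2-1$. *)

(* Defs.v *)
From HB Require Import structures.
From mathcomp Require Import all_boot all_order all_algebra.
From mathcomp Require Import spectral.
From mathcomp Require Import all_classical reals.
From mathcomp Require Import complex.
From mathcomp Require mxtens.

Set Implicit Arguments.
Unset Strict Implicit.
Unset Printing Implicit Defensive.

Import Order.TTheory GRing.Theory Num.Theory.

Local Open Scope classical_set_scope.
Local Open Scope ring_scope.
Local Open Scope complex_scope.
Local Open Scope sesquilinear_scope.

Definition inner (R : realType) (d : nat) (u v : 'cV[R[i]]_d) : R[i] :=
  (u ^t* *m v) 0 0.

Definition ketbra (R : realType) (d : nat) (u : 'cV[R[i]]_d) : 'M[R[i]]_d :=
  u *m u ^t*.

(* For d >= 1 the index type 'I_(d ^ 2).-1.+1 is {0, ..., d^2 - 1}; the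
   successor form makes [ord0] and [lift ord0] available without casts. *)
Definition operator_basis (R : realType) (d : nat)
    (lam : 'I_(d ^ 2).-1.+1 -> 'M[R[i]]_d) : Prop :=
  [/\ lam ord0 = 1%:M,
      (forall i, lam i \is hermsymmx) &
      (forall i j, \tr (lam i *m lam j) = d%:R * (i == j)%:R)].

(* [lift ord0] enumerates the indices 1, ..., d^2 - 1.  For Hermitian rho the
   traces are real, so taking the real part only changes their type. *)
Definition correlation_matrix (R : realType) (d : nat)
    (lam : 'I_(d ^ 2).-1.+1 -> 'M[R[i]]_d) (rho : 'M[R[i]]_(d * d)) :
    'M[R]_((d ^ 2).-1) :=
  \matrix_(i, j)
    complex.Re (\tr (rho *m mxtens.tensmx (lam (lift ord0 i))
                                          (lam (lift ord0 j)))).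

(* T is real, so its adjoint is its transpose. *)
Definition moment2 (R : realType) (d : nat) (T : 'M[R]_((d ^ 2).-1)) : R :=
  \tr (T *m T^T) / (d%:R - 1) ^+ 2.

Definition moment4 (R : realType) (d : nat) (T : 'M[R]_((d ^ 2).-1)) : R :=
  (2 * \tr (T *m T^T *m T *m T^T) + (\tr (T *m T^T)) ^+ 2)
    / (3 * (d%:R - 1) ^+ 4).

(* Both moments depend only on the singular values s of T, so they are
   evaluated on [diag_mx s]; the trace norm of T is the sum of s. *)
Definition feasible_moment4 (R : realType) (d : nat) (x : R) : set R :=
  [set moment4 (diag_mx s) | s in
    [set s : 'rV[R]_((d ^ 2).-1) |
      [/\ (forall i, 0 <= s 0 i),
          \sum_i s 0 i <= d%:R - 1 &
          moment2 (diag_mx s) = x]]].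

(* The minimum of [feasible_moment4 d x], i.e. the lower bound belonging to the
   set, with default value 0 when there is none.  For x <> 0 all feasible
   values are positive, so the default cannot be mistaken for a minimum. *)
Definition f_lb (R : realType) (d : nat) (x : R) : R :=
  xget 0 (feasible_moment4 d x `&` lbound (feasible_moment4 d x)).

Definition rho_mix (R : realType) (d N : nat)
    (psi : 'I_N -> 'cV[R[i]]_d) (psi' : 'cV[R[i]]_d) (p : R) :
    'M[R[i]]_(d * d) :=
  (p / N%:R)%:C *: (\sum_i mxtens.tensmx (ketbra (psi i)) (ketbra (psi i)))
  + (1 - p)%:C *: mxtens.tensmx (ketbra psi') (ketbra psi').

(* Main.v *)
(** A product state has correlation matrix a a^T with a the Bloch vector of the
    factor; the overlaps 1 / sqrt d make the Bloch vectors of the psi's orthogonal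
    of square norm d - 1. Hence (d - 1) p / N (N times) and (d - 1) (1 - p) are the
    nonzero singular values of T, and N + 1 <= d^2 - 1.

    To see that this spectrum minimises the quartic sum, take a minimiser (it exists
    by compactness) among the nonnegative vectors with the same first and second
    power sums as a given competitor. If three of its entries satisfied
    0 < u <= v < w, lowering u slightly while keeping both power sums would decrease
    the quartic sum; so they are k copies of some A, at most one B < A, and zeros.
    Such block spectra are compared directly, according to k < N, k = N or k > N. *)

Require Import Defs.
From HB Require Import structures.
From mathcomp Require Import all_boot all_order all_algebra.
From mathcomp Require Import spectral.
From mathcomp Require Import all_classical reals.
From mathcomp Require Import topology normedtype derive realfun.
From mathcomp Require Import ring lra.
From mathcomp Require Import complex.
Import Order.TTheory GRing.Theory Num.Theory.
Import numFieldNormedType.Exports.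
Local Open Scope classical_set_scope.
Local Open Scope ring_scope.
Local Open Scope complex_scope.
Local Open Scope sesquilinear_scope.

(** * Comparison of block spectra *)

Lemma block_quartic_le (R : realFieldType) (N k : nat) (a b A B : R) :
  (0 < k)%N -> 0 <= b <= a -> 0 <= B < A ->
  k%:R * A + B <= N%:R * a + b ->
  k%:R * A ^+ 2 + B ^+ 2 = N%:R * a ^+ 2 + b ^+ 2 ->
  N%:R * a ^+ 4 + b ^+ 4 <= k%:R * A ^+ 4 + B ^+ 4.
Proof.
move=> k_gt0 /andP[b0 ba] /andP[B0 BA] h1 h2.
have a0 : 0 <= a by exact: le_trans ba.
have A0 : 0 < A by exact: le_lt_trans BA.
have A0w := ltW A0.
have k0 : (0 : R) <= k%:R by rewrite ler0n.
have N0 : (0 : R) <= N%:R by rewrite ler0n.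
case: (ltngtP k N) => [kN|Nk|kN].
- have {}kN : k%:R + 1 <= N%:R :> R by rewrite natr1 ler_nat.
  (* The tangent to t^2 at t = a^2 bounds the quartic sum from below; the last summand pads the k +
     1 entries to N. *)
  have e1 : 0 <= k%:R * (A ^+ 2 - a ^+ 2) ^+ 2
                 + (B ^+ 2 - a ^+ 2) ^+ 2 + (N%:R - k%:R - 1) * a ^+ 4.
    apply: addr_ge0; last by apply: mulr_ge0; [lra | exact: exprn_ge0].
    by rewrite addr_ge0 ?sqr_ge0 // mulr_ge0 ?sqr_ge0.
  have e2 : b ^+ 2 * b ^+ 2 <= a ^+ 2 * b ^+ 2.
    by rewrite ler_wpM2r ?sqr_ge0// lerXn2r ?nnegrE.
  have e3 : 0 <= a ^+ 2 * b ^+ 2 by rewrite mulr_ge0 ?sqr_ge0.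
  have e4 : a ^+ 2 * (k%:R * A ^+ 2 + B ^+ 2) = a ^+ 2 * (N%:R * a ^+ 2 + b ^+ 2).
    by rewrite h2.
  lra.
- have {}Nk : N%:R + 1 <= k%:R :> R by rewrite natr1 ler_nat.
  (* Here (k A + B)^2 >= k (k A^2 + B^2), while Cauchy-Schwarz gives (N a + b)^2 <= (N + 1) (N a^2 +
     b^2). So the slacks in [e2], [e3] and [e4] all vanish and the two spectra coincide. *)
  have e1 : (k%:R * A + B) ^+ 2 <= (N%:R * a + b) ^+ 2.
    by rewrite lerXn2r ?nnegrE ?addr_ge0 ?mulr_ge0.
  have e2 : 0 <= N%:R * (a - b) ^+ 2 by rewrite mulr_ge0 ?sqr_ge0.
  have e3 : 0 <= (k%:R - (N%:R + 1)) * (k%:R * A ^+ 2 + B ^+ 2).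
    apply: mulr_ge0; first lra.
    by rewrite addr_ge0 ?sqr_ge0 // mulr_ge0 ?sqr_ge0.
  have kAB : 0 <= k%:R * (A - B) by rewrite mulr_ge0 ?subr_ge0 // ltW.
  have kA : 0 < k%:R * A by rewrite mulr_gt0 ?ltr0n.
  have cpos : 0 < k%:R * (A - B) + k%:R * A + B by lra.
  have e4 : 0 <= B * (k%:R * (A - B) + k%:R * A + B) by rewrite mulr_ge0 // ltW.
  have xpos : 0 < k%:R * A ^+ 2 + B ^+ 2.
    by rewrite ltr_wpDr ?sqr_ge0 // mulr_gt0 ?ltr0n // exprn_gt0.
  have h3 : N%:R * (k%:R * A ^+ 2 + B ^+ 2) =
            N%:R * (N%:R * a ^+ 2 + b ^+ 2) by rewrite h2.
  have z2 : N%:R * (a - b) ^+ 2 = 0 by lra.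
  have z3 : (k%:R - (N%:R + 1)) * (k%:R * A ^+ 2 + B ^+ 2) = 0 by lra.
  have z4 : B * (k%:R * (A - B) + k%:R * A + B) = 0 by lra.
  have kE : k%:R = N%:R + 1 :> R.
    by move/eqP: z3; rewrite mulf_eq0 (gt_eqF xpos) orbF subr_eq0 => /eqP.
  have BE : B = 0 by move/eqP: z4; rewrite mulf_eq0 (gt_eqF cpos) orbF => /eqP.
  have bsq : b ^+ 2 <= a ^+ 2 by rewrite lerXn2r ?nnegrE.
  have : N%:R * a ^+ 4 + b ^+ 4 <= (N%:R + 1) * (A ^+ 2) ^+ 2.
    have [N00|Nn0] := eqVneq (N%:R : R) 0.
      move: h2; rewrite kE BE N00 => h2.
      have -> : A ^+ 2 = b ^+ 2 by lra.
      by lra.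
    have ab : a = b.
      by move/eqP: z2; rewrite mulf_eq0 (negbTE Nn0) /= sqrf_eq0 subr_eq0 => /eqP.
    have N10 : N%:R + 1 != 0 :> R by lra.
    have -> : A ^+ 2 = a ^+ 2.
      by apply: (mulfI N10); move: h2; rewrite kE BE -ab; lra.
    by rewrite -ab; lra.
  by rewrite kE BE; lra.
- subst k.
  (* If A < a, the equal square sums give N (a - A) (a + A) = (B - b) (B + b) with B - b <= N (a -
     A), although B + b < a + A. *)
  have Aa : a <= A.
    rewrite leNgt; apply/negP => Aa.
    have p1 : 0 < N%:R * (a - A) by rewrite mulr_gt0 ?ltr0n ?subr_gt0.
    have p2 : (N%:R * (a - A)) * (a + A) = (B - b) * (B + b) by lra.
    have Bb : B - b <= N%:R * (a - A) by lra.
    have p3 : (B - b) * (B + b) <= N%:R * (a - A) * (B + b).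
      by rewrite ler_wpM2r ?addr_ge0.
    have : 0 < (N%:R * (a - A)) * (a + A - B - b) by rewrite mulr_gt0; lra.
    lra.
  (* Tangents to t^2 at a^2 and b^2: since N (A^2 - a^2) = b^2 - B^2, the first-order terms add up
     to 2 N (A^2 - a^2) (a^2 - b^2) >= 0. *)
  have q1 : 0 <= N%:R * (A ^+ 2 - a ^+ 2) ^+ 2.
    by rewrite mulr_ge0 ?sqr_ge0.
  have q2 : 0 <= (B ^+ 2 - b ^+ 2) ^+ 2 by rewrite sqr_ge0.
  have q3 : 0 <= N%:R * (A ^+ 2 - a ^+ 2) * (a ^+ 2 - b ^+ 2).
    by rewrite !mulr_ge0 // subr_ge0 lerXn2r ?nnegrE // ltW.
  have q4 : b ^+ 2 * (N%:R * A ^+ 2 + B ^+ 2) = b ^+ 2 * (N%:R * a ^+ 2 + b ^+ 2).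
    by rewrite h2.
  lra.
Qed.

(** * The exchange step on three entries *)

(** The entry u drops to u - e; the other two become the roots of the quadratic with sum v + w + e
    and the product that keeps the sum of squares. *)
Lemma lower_quartic3 (R : rcfType) (u v w : R) : 0 < u -> u <= v -> v < w ->
  exists u' v' w' : R,
    [/\ [/\ 0 <= u', 0 <= v' & 0 <= w'], u' + v' + w' = u + v + w,
        u' ^+ 2 + v' ^+ 2 + w' ^+ 2 = u ^+ 2 + v ^+ 2 + w ^+ 2 &
        u' ^+ 4 + v' ^+ 4 + w' ^+ 4 < u ^+ 4 + v ^+ 4 + w ^+ 4].
Proof.
move=> u0 uv vw.
have v0 : 0 < v by lra.
have w0 : 0 < w by lra.
pose S := v + w; have S0 : 0 < S by rewrite /S; lra.
(* This choice makes e = u r at most u / 2 and 2 e S at most (w - v)^2, so that the discriminant q^2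
   of the new pair is nonnegative. *)
pose r := ((w - v) / S) ^+ 2 / 2.
have rS : 2 * r * S ^+ 2 = (w - v) ^+ 2 by rewrite /r; field; lra.
have r0 : 0 < r by rewrite /r divr_gt0 // exprn_gt0 // divr_gt0 // subr_gt0.
have r1 : r <= 1 / 2.
  rewrite /r ler_pM2r ?invr_gt0 // expr_le1 ?divr_ge0 ?subr_ge0 1?ltW //.
  by rewrite ltr_pdivrMr // /S; lra.
pose e := u * r.
have e0 : 0 < e by rewrite mulr_gt0.
have eu : e <= u by rewrite /e ger_pMr //; lra.
have ue : 0 <= u * (S - u) by rewrite mulr_ge0 // /S; lra.
have disc : 2 * (S - 2 * u) * e + 3 * e ^+ 2 <= (w - v) ^+ 2.
  have e1 : e * e <= e * u by rewrite ler_wpM2l // ltW.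
  have e2 : e * S <= r * S ^+ 2.
    have -> : e * S = r * (u * S) by rewrite /e; ring.
    rewrite ler_pM2l // expr2 ler_pM2r // /S; lra.
  have e3 : 0 <= e * u by rewrite mulr_ge0 // ltW.
  rewrite -rS; lra.
pose q := Num.sqrt ((w - v) ^+ 2 - (2 * (S - 2 * u) * e + 3 * e ^+ 2)).
have q0 : 0 <= q by rewrite sqrtr_ge0.
have qE : q ^+ 2 = (w - v) ^+ 2 - (2 * (S - 2 * u) * e + 3 * e ^+ 2).
  by rewrite sqr_sqrtr // subr_ge0.
(* Four times the product of the new pair; its sign yields q <= S + e, hence a nonnegative smaller
   root. *)
have prodE : (S + e) ^+ 2 - q ^+ 2 = 4 * (v * w + e * (S - u) + e ^+ 2).
  by rewrite qE /S; ring.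
have qS : q <= S + e.
  rewrite -(@ler_pXn2r _ 2) ?nnegrE //; last by rewrite addr_ge0 // ltW.
  rewrite -subr_ge0 prodE mulr_ge0 // !addr_ge0 ?sqr_ge0 //.
    by rewrite mulr_ge0 // ltW.
  by rewrite mulr_ge0 // ?ltW // /S; lra.
exists (u - e), ((S + e - q) / 2), ((S + e + q) / 2); split.
- by split; lra.
- by rewrite /S; field.
- have -> : (u - e) ^+ 2 + ((S + e - q) / 2) ^+ 2 + ((S + e + q) / 2) ^+ 2 =
   (u - e) ^+ 2 + ((S + e) ^+ 2 + q ^+ 2) / 2 by field.
  by rewrite qE /S; field.
have -> : (u - e) ^+ 4 + ((S + e - q) / 2) ^+ 4 + ((S + e + q) / 2) ^+ 4 =
  (u - e) ^+ 4 + (((S + e) ^+ 2) ^+ 2 + 6 * (S + e) ^+ 2 * q ^+ 2 + (q ^+ 2) ^+ 2) / 8.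
  by field.
rewrite qE -subr_gt0.
(* With the sums of first and second powers fixed, the quartic sum is 4 (u + v + w)
   times the product u v w up to a constant, and lowering u to u - e changes this
   product by (u' - u) (u' - v) (u' - w) at u' = u - e. *)
have -> : u ^+ 4 + v ^+ 4 + w ^+ 4 - ((u - e) ^+ 4 + (((S + e) ^+ 2) ^+ 2 +
   6 * (S + e) ^+ 2 * ((w - v) ^+ 2 - (2 * (S - 2 * u) * e + 3 * e ^+ 2))
   + ((w - v) ^+ 2 - (2 * (S - 2 * u) * e + 3 * e ^+ 2)) ^+ 2) / 8) =
   4 * (u + v + w) * (e * ((v - u + e) * (w - u + e))).
  by rewrite /S; field.
apply: mulr_gt0; first lra.
by apply: mulr_gt0 => //; apply: mulr_gt0; lra.
Qed.

(** * The shape of a minimiser *)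

(** A is the largest entry and k its multiplicity; two positive entries below A would form a
    forbidden triple with A. Quantifying over f covers the exponents 1, 2 and 4 at once. *)
Lemma block_decomposition (R : realDomainType) n (s : 'I_n -> R) :
  (forall i, 0 <= s i) -> (exists i, s i != 0) ->
  (forall i j k, i != j -> 0 < s i -> s i <= s j -> s j < s k -> False) ->
  exists k A B, [/\ (0 < k)%N, 0 <= B < A &
    forall f : R -> R, f 0 = 0 -> \sum_i f (s i) = k%:R * f A + f B].
Proof.
move=> s0 [i1 si1] H.
have [i0 _ i0max] := @arg_maxP _ _ _ i1 xpredT s isT.
set A := s i0.
have i0max' l : s l <= A by exact: i0max.
have A0 : 0 < A.
  by rewrite (lt_le_trans _ (i0max' i1)) // lt_neqAle eq_sym si1 s0.
have ltA l : s l != A -> s l < A by move=> h; rewrite lt_neqAle h i0max'.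
have split_sum (f : R -> R) : \sum_i f (s i) =
    #|[pred i | s i == A]|%:R * f A + \sum_(i | s i != A) f (s i).
  rewrite (bigID (fun i => s i == A)) /=; congr (_ + _).
  rewrite (eq_bigr (fun=> f A)); last by move=> i /eqP ->.
  by rewrite sumr_const mulr_natl.
have kpos : (0 < #|[pred i | s i == A]|)%N.
  by apply/card_gt0P; exists i0; rewrite inE.
have [[j /andP[sj0 sjA]]|none] := pselect (exists j, (s j != 0) && (s j != A)).
  exists #|[pred i | s i == A]|, A, (s j); split=> //; first by rewrite s0 ltA.
  move=> f f0; rewrite split_sum (bigD1 j) //= big1 ?addr0 // => l /andP[slA lj].
  have [->//|sl0] := eqVneq (s l) 0.
  have pj : 0 < s j by rewrite lt_neqAle eq_sym sj0 s0.
  have pl : 0 < s l by rewrite lt_neqAle eq_sym sl0 s0.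
  exfalso; have [ljle|jl] := leP (s l) (s j).
    exact: (H l j i0 lj pl ljle (ltA _ sjA)).
  by apply: (H j l i0 _ pj (ltW jl) (ltA _ slA)); rewrite eq_sym.
exists #|[pred i | s i == A]|, A, 0; split=> //; first by rewrite lexx.
move=> f f0; rewrite split_sum big1 ?f0 // => l slA.
have [->//|sl0] := eqVneq (s l) 0.
by exfalso; apply: none; exists l; rewrite sl0.
Qed.

(** * Existence of a minimiser *)

Lemma continuous_sum_exp (R : realType) n m :
  continuous (fun t : 'rV[R]_n => \sum_i t 0 i ^+ m).
Proof.
apply: continuous_big => [|i _ t]; first exact: add_continuous.
apply: (@continuous_comp _ _ _ (fun t : 'rV[R]_n => t 0 i) (fun x => x ^+ m)).
  exact: coord_continuous.
exact: exprn_continuous.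
Qed.

Lemma exists_quartic_minimizer (R : realType) n (s : 'rV[R]_n) :
  (forall i, 0 <= s 0 i) ->
  exists t : 'rV[R]_n,
    [/\ forall i, 0 <= t 0 i, \sum_i t 0 i = \sum_i s 0 i,
        \sum_i t 0 i ^+ 2 = \sum_i s 0 i ^+ 2 &
        forall t' : 'rV[R]_n, (forall i, 0 <= t' 0 i) ->
          \sum_i t' 0 i = \sum_i s 0 i ->
          \sum_i t' 0 i ^+ 2 = \sum_i s 0 i ^+ 2 ->
          \sum_i t 0 i ^+ 4 <= \sum_i t' 0 i ^+ 4].
Proof.
move=> s0; set c := \sum_i s 0 i; set x := \sum_i s 0 i ^+ 2.
(* Nonnegative entries of sum c lie in [0, c], so the feasible set is a closed part of a compact
   box. *)
pose box := [set v : 'rV[R]_n | forall i, v ord0 i \in `[0, c]].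
(* The exponent 1 brings the plain sum under [continuous_sum_exp]. *)
pose K := (box `&` (fun t : 'rV[R]_n => \sum_i t 0 i ^+ 1) @^-1` [set c])
           `&` (fun t : 'rV[R]_n => \sum_i t 0 i ^+ 2) @^-1` [set x].
have KP (t : 'rV[R]_n) : (forall i, 0 <= t 0 i) -> \sum_i t 0 i = c ->
    \sum_i t 0 i ^+ 2 = x -> K t.
  move=> t0 tc tx; split=> //; split=> [i|].
    rewrite in_itv /= t0 -tc (bigD1 i) //= lerDl sumr_ge0 //.
  by rewrite /=; under eq_bigr do rewrite expr1.
have cK : compact K.
  apply: compact_closedI; last first.
    apply: preimage_closed; [|exact: closed_eq].
    by move=> ? _; exact: continuous_sum_exp.
  apply: compact_closedI; last first.
    apply: preimage_closed; [|exact: closed_eq].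
    by move=> ? _; exact: continuous_sum_exp.
  apply: (@rV_compact _ _ (fun=> `[0, c]%classic)).
  by move=> _; exact: segment_compact.
have [||t tK tmin] := @compact_EVT_min _ R
    (fun t : 'rV[R]_n => \sum_i t 0 i ^+ 4) K _ cK.
- by exists s; exact: KP.
- by apply: continuous_subspaceT; exact: continuous_sum_exp.
have [[tbox tc] tx] := set_mem tK.
exists t; split=> //.
- by move=> i; have := tbox i; rewrite in_itv => /andP[].
- by move=> t' t'0 t'c t'x; apply: tmin; rewrite inE; exact: KP.
Qed.

(** * The quartic bound for an arbitrary spectrum *)

(** Serves to compare the power sums of a spectrum before and after the exchange step. *)
Lemma sum_update3 (R : comNzRingType) n (s : 'I_n -> R) (i j k : 'I_n) (u v w : R)
    (f : R -> R) : i != j -> i != k -> j != k ->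
  \sum_l f (if l == i then u else if l == j then v else if l == k then w
            else s l) =
  \sum_l f (s l) + (f u + f v + f w) - (f (s i) + f (s j) + f (s k)).
Proof.
move=> ij ik jk.
have ji : j != i by rewrite eq_sym.
have ki : k != i by rewrite eq_sym.
have kj : k != j by rewrite eq_sym.
have split_sum (g : 'I_n -> R) : \sum_l g l =
    g i + (g j + (g k + \sum_(l | [&& l != i, l != j & l != k]) g l)).
  rewrite (bigD1 i) //= (bigD1 j) //= (bigD1 k) /= ?ki //.
  by do 3 congr (_ + _); apply: eq_bigl => l; rewrite andbA.
rewrite !split_sum !eqxx (negbTE ji) (negbTE ki) (negbTE kj).
under eq_bigr => l /and3P[/negbTE-> /negbTE-> /negbTE->] do [].
set Z := \sum_(_ | _) _.
ring.
Qed.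

Lemma sum_quartic_ge (R : realType) n N (a b : R) (s : 'rV[R]_n) :
  0 <= b <= a -> (forall i, 0 <= s 0 i) ->
  \sum_i s 0 i <= N%:R * a + b ->
  \sum_i s 0 i ^+ 2 = N%:R * a ^+ 2 + b ^+ 2 ->
  N%:R * a ^+ 4 + b ^+ 4 <= \sum_i s 0 i ^+ 4.
Proof.
move=> bab s0 s1 s2.
have [t [t0 t1 t2 tmin]] := exists_quartic_minimizer _ _ _ s0.
apply: le_trans (tmin s s0 erefl erefl).
(* The zero vector has no block form with A > 0 and is treated apart: N a^2 + b^2 = 0 makes both
   sides vanish. *)
have [nz|z] := pselect (exists i, t 0 i != 0); last first.
  have {}z i : t 0 i = 0.
    by apply/eqP; apply: contrapT => /negP h; apply: z; exists i.
  have x0 : N%:R * a ^+ 2 + b ^+ 2 = 0.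
    by rewrite -s2 -t2 big1 // => i _; rewrite z expr0n.
  have e : (N%:R * a ^+ 2 + b ^+ 2) * (a ^+ 2 + b ^+ 2) = 0 by rewrite x0 mul0r.
  have p1 : 0 <= N%:R * a ^+ 2 * b ^+ 2.
    by rewrite mulr_ge0 ?sqr_ge0 // mulr_ge0 ?sqr_ge0.
  have p2 : 0 <= a ^+ 2 * b ^+ 2 by rewrite mulr_ge0 ?sqr_ge0.
  rewrite big1 => [|i _]; last by rewrite z expr0n.
  lra.
have [|k [A [B [k0 BA tE]]]] := block_decomposition _ _ (t 0) t0 nz.
  move=> i j k ij ti tij tjk.
  have ik : i != k by apply/eqP => e; move: (le_lt_trans tij tjk); rewrite e ltxx.
  have jk : j != k by apply/eqP => e; move: tjk; rewrite e ltxx.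
  have [u [v [w [[u0 v0 w0] e1 e2 e4]]]] := lower_quartic3 _ _ _ _ ti tij tjk.
  (* The exchanged vector keeps the first two power sums, so its smaller quartic sum contradicts the
     minimality of t. *)
  pose t' : 'rV[R]_n := \row_l if l == i then u else if l == j then v else
    if l == k then w else t 0 l.
  have t'E (f : R -> R) : \sum_l f (t' 0 l) =
    \sum_l f (t 0 l) + (f u + f v + f w) - (f (t 0 i) + f (t 0 j) + f (t 0 k)).
    by rewrite -sum_update3 //; apply: eq_bigr => l _; rewrite mxE.
  have := tmin t'; rewrite (t'E id) (t'E (fun x => x ^+ 2)) (t'E (fun x => x ^+ 4)).
  rewrite /= e1 e2 !addrK => /(_ _ t1 t2) /=.
  suff t'0 l : 0 <= t' 0 l by move/(_ t'0); lra.
  by rewrite mxE; do 3 case: ifP => // _.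
have z2 : (0 : R) ^+ 2 = 0 by rewrite expr0n.
have z4 : (0 : R) ^+ 4 = 0 by rewrite expr0n.
rewrite (tE (fun x => x ^+ 4) z4); apply: block_quartic_le => //.
  by rewrite -(tE id) // t1.
by rewrite -(tE (fun x => x ^+ 2) z2) t2.
Qed.

(** * Parseval identity for the operator basis *)

Lemma mxtrace_tens (R : pzRingType) m n (A : 'M[R]_m) (B : 'M[R]_n) :
  \tr (mxtens.tensmx A B) = \tr A * \tr B.
Proof.
by rewrite /mxtrace mxtens.mulr_sum; apply: eq_bigr => i _; rewrite mxE.
Qed.

Lemma mul_mxvec_tr (R : comPzRingType) m n (A : 'M[R]_(m, n)) (B : 'M[R]_(n, m)) :
  (mxvec A *m (mxvec B^T)^T) 0 0 = \tr (A *m B).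
Proof.
rewrite mxE (reindex _ (curry_mxvec_bij _ _)) /=.
transitivity (\sum_i \sum_j A i j * B j i).
  rewrite pair_bigA; apply: eq_bigr => -[i j] _ /=.
  by rewrite [(_ ^T) _ 0]mxE !mxvecE mxE.
by apply: eq_bigr => i _; rewrite mxE.
Qed.

(** The sizes [(d ^ 2).-1.+1] and [d * d] are equal but not convertible; the hypothesis m = n stands
    in for a cast. *)
Lemma mulmx1C_eq (R : comPzRingType) m n (A : 'M[R]_(m, n)) (B : 'M[R]_(n, m)) :
  m = n -> A *m B = 1%:M -> B *m A = 1%:M.
Proof. by move=> mn; subst n; exact: mulmx1C. Qed.

(** Orthogonality says that the square matrix [L] of vectorised basis elements has the right inverse
    [c^-1 *: L'^T]; it is also a left inverse, which is the completeness relation. *)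
Lemma parseval_basis (F : fieldType) (d m : nat) (c : F) (lam : 'I_m -> 'M[F]_d)
    (P Q : 'M[F]_d) : m = (d * d)%N -> c != 0 ->
  (forall i j, \tr (lam i *m lam j) = c * (i == j)%:R) ->
  \sum_i \tr (P *m lam i) * \tr (Q *m lam i) = c * \tr (P *m Q).
Proof.
move=> md c0 ortho.
pose L : 'M_(m, d * d) := \matrix_i mxvec (lam i).
pose L' : 'M_(m, d * d) := \matrix_i mxvec (lam i)^T.
have LL' : L *m (c^-1 *: L'^T) = 1%:M.
  apply/matrixP => i j; rewrite -scalemxAr mxE.
  have -> : (L *m L'^T) i j = (row i L *m (row j L')^T) 0 0.
    by rewrite !mxE; apply: eq_bigr => k _; rewrite !mxE.
  by rewrite !rowK mul_mxvec_tr ortho mulKf // mxE.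
have L'L := mulmx1C_eq _ _ _ _ _ md LL'.
have -> : \sum_i \tr (P *m lam i) * \tr (Q *m lam i) =
    (mxvec P *m L'^T *m (L *m (mxvec Q^T)^T)) 0 0.
  rewrite mxE; apply: eq_bigr => i _; congr (_ * _).
    rewrite -mul_mxvec_tr -[mxvec (lam i)^T](rowK (fun i => mxvec (lam i)^T)).
    by rewrite !mxE; apply: eq_bigr => k _; rewrite !mxE.
  rewrite mxtrace_mulC -mul_mxvec_tr -[mxvec (lam i)](rowK (fun i => mxvec (lam i))).
  by rewrite !mxE; apply: eq_bigr => k _; rewrite !mxE.
rewrite mulmxA -(mulmxA (mxvec P)).
have -> : L'^T *m L = c%:M.
  by rewrite -[L'^T *m L](scalerKV c0) scalemxAl L'L scale_scalar_mx mulr1.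
by rewrite mul_mx_scalar -scalemxAl mxE mul_mxvec_tr.
Qed.

(** * Pure states and Bloch vectors *)

Lemma mxtrace_ketbra (R : realType) d (u : 'cV[R[i]]_d) :
  \tr (ketbra u) = inner u u.
Proof. by rewrite /ketbra mxtrace_mulC /mxtrace big_ord1. Qed.

Lemma inner_conj (R : realType) d (u v : 'cV[R[i]]_d) :
  inner v u = (inner u v)^*%R.
Proof.
rewrite /inner !mxE rmorph_sum; apply: eq_bigr => i _.
by rewrite !mxE rmorphM /= conjCK mulrC.
Qed.

Lemma mxtrace_ketbraM (R : realType) d (u v : 'cV[R[i]]_d) :
  \tr (ketbra u *m ketbra v) = `|inner u v| ^+ 2.
Proof.
rewrite /ketbra mulmxA mxtrace_mulC !mulmxA -mulmxA /mxtrace big_ord1 mxE big_ord1.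
by rewrite -/(inner u v) -/(inner v u) (inner_conj _ _ u v) mulrC normCK.
Qed.

(** Conjugating the trace reverses the product of two Hermitian factors, and cyclicity restores the
    order. Hence the real part in [bloch] loses nothing. *)
Lemma mxtrace_ketbra_real (R : realType) d (u : 'cV[R[i]]_d) (A : 'M[R[i]]_d) :
  A \is hermsymmx -> \tr (ketbra u *m A) \is Num.real.
Proof.
move=> /is_hermitianmxP; rewrite expr0 scale1r => Ah.
have Kh : ketbra u ^t* = ketbra u.
  by rewrite /ketbra trmx_mul map_mxM /= trmxCK.
apply/CrealP; rewrite -trace_map_mx -mxtrace_tr map_mxM /= trmx_mul !map_trmx.
by rewrite mxtrace_mulC Kh -Ah.
Qed.

Definition bloch (R : realType) (d : nat)
    (lam : 'I_(d ^ 2).-1.+1 -> 'M[R[i]]_d) (u : 'cV[R[i]]_d) : 'rV[R]_((d ^ 2).-1) :=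
  \row_j complex.Re (\tr (ketbra u *m lam (lift ord0 j))).

Arguments bloch {R d} lam u.

Lemma blochE (R : realType) (d : nat) (lam : 'I_(d ^ 2).-1.+1 -> 'M[R[i]]_d)
    (u : 'cV[R[i]]_d) j : operator_basis lam ->
  (bloch lam u 0 j)%:C = \tr (ketbra u *m lam (lift ord0 j)).
Proof. by case=> _ hs _; rewrite mxE RRe_real // mxtrace_ketbra_real. Qed.

(** Parseval for the two projectors: the full sum is d r^2, and the identity component accounts for
    the subtracted 1. *)
Lemma bloch_dot (R : realType) (d : nat) (lam : 'I_(d ^ 2).-1.+1 -> 'M[R[i]]_d)
    (u v : 'cV[R[i]]_d) (r : R) : (0 < d)%N -> operator_basis lam ->
  inner u u = 1 -> inner v v = 1 -> `|inner u v| = r%:C ->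
  \sum_j bloch lam u 0 j * bloch lam v 0 j = d%:R * r ^+ 2 - 1.
Proof.
move=> d0 basis u1 v1 uvr; apply: complexI.
rewrite rmorph_sum.
under eq_bigr do rewrite rmorphM /= !blochE //.
have [lam0 _ ortho] := basis.
have dd : (d ^ 2).-1.+1 = (d * d)%N by rewrite prednK ?expn_gt0 ?d0 // mulnn.
have dn0 : (d%:R : R[i]) != 0 by rewrite pnatr_eq0 -lt0n.
have := parseval_basis _ _ _ _ _ (ketbra u) (ketbra v) dd dn0 ortho.
rewrite big_ord_recl lam0 !mulmx1 !mxtrace_ketbra u1 v1 mulr1 mxtrace_ketbraM uvr.
move=> /(canRL (addKr _)) ->; rewrite addrC rmorphB rmorphM rmorphXn /= rmorph1.
by rewrite rmorph_nat.
Qed.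

(** * Moments of a matrix built on orthogonal rows *)

Section GramTrace.
Variables (R : comPzRingType) (m n : nat) (V : 'M[R]_(m, n)) (c : R).
Hypothesis gram : V *m V^T = c%:M.

(** Up to the factor c, the map from A to V^T A V is multiplicative; this gives the traces of powers
    without any singular value decomposition. *)
Lemma gram_mulmx (A B : 'M[R]_m) :
  (V^T *m A *m V) *m (V^T *m B *m V) = c *: (V^T *m (A *m B) *m V).
Proof.
rewrite -!mulmxA [V *m (V^T *m _)]mulmxA gram mul_scalar_mx.
by rewrite -!scalemxAr !mulmxA.
Qed.

Lemma gram_mxtrace (A : 'M[R]_m) : \tr (V^T *m A *m V) = c * \tr A.
Proof. by rewrite mxtrace_mulC mulmxA gram mul_scalar_mx mxtraceZ. Qed.

End GramTrace.

(** Besides zeros, T has the singular values c |w_i|; each product and the final trace release one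
    factor c. *)
Lemma moments_gram (R : realType) (d m : nat) (V : 'M[R]_(m, (d ^ 2).-1)) (c : R)
    (w : 'rV[R]_m) : V *m V^T = c%:M ->
  let T := V^T *m diag_mx w *m V in
  moment2 T = c ^+ 2 * (\sum_i w 0 i ^+ 2) / (d%:R - 1) ^+ 2 /\
  moment4 T = c ^+ 4 * (2 * (\sum_i w 0 i ^+ 4) + (\sum_i w 0 i ^+ 2) ^+ 2)
    / (3 * (d%:R - 1) ^+ 4).
Proof.
move=> gram T.
have TT : T^T = T by rewrite /T !trmx_mul trmxK tr_diag_mx mulmxA.
have t2 : \tr (T *m T^T) = c ^+ 2 * (\sum_i w 0 i ^+ 2).
  rewrite TT /T (gram_mulmx _ _ _ _ _ gram) mxtraceZ (gram_mxtrace _ _ _ _ _ gram).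
  rewrite mulmx_diag mxtrace_diag mulrA -expr2; congr (_ * _).
  by apply: eq_bigr => i _; rewrite mxE.
have t4 : \tr (T *m T^T *m T *m T^T) = c ^+ 4 * (\sum_i w 0 i ^+ 4).
  rewrite TT -mulmxA /T (gram_mulmx _ _ _ _ _ gram) -scalemxAl -scalemxAr.
  rewrite (gram_mulmx _ _ _ _ _ gram) !mxtraceZ (gram_mxtrace _ _ _ _ _ gram).
  rewrite !mulmx_diag mxtrace_diag !mulrA; congr (_ * _); first by ring.
  by apply: eq_bigr => i _; rewrite !mxE; ring.
by rewrite /moment2 /moment4 t2 t4; split=> //; congr (_ / _); ring.
Qed.

Lemma moments_diag (R : realType) (d : nat) (s : 'rV[R]_((d ^ 2).-1)) :
  moment2 (diag_mx s) = (\sum_i s 0 i ^+ 2) / (d%:R - 1) ^+ 2 /\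
  moment4 (diag_mx s) = (2 * (\sum_i s 0 i ^+ 4) + (\sum_i s 0 i ^+ 2) ^+ 2)
    / (3 * (d%:R - 1) ^+ 4).
Proof.
have gram : 1%:M *m 1%:M^T = 1%:M :> 'M[R]_((d ^ 2).-1) by rewrite mul1mx trmx1.
have := moments_gram _ _ _ _ _ s gram.
by rewrite /= trmx1 mul1mx mulmx1 !expr1n !mul1r.
Qed.

Lemma bloch_gram (R : realType) (d m : nat) (lam : 'I_(d ^ 2).-1.+1 -> 'M[R[i]]_d)
    (phi : 'I_m -> 'cV[R[i]]_d) : (0 < d)%N -> operator_basis lam ->
  (forall k, inner (phi k) (phi k) = 1) ->
  (forall k l, k != l -> `|inner (phi k) (phi l)| = (1 / Num.sqrt d%:R)%:C) ->
  let V := \matrix_k bloch lam (phi k) in V *m V^T = (d%:R - 1)%:M.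
Proof.
move=> d0 basis phi1 phi_mub V.
have dn0 : d%:R != 0 :> R by rewrite pnatr_eq0 -lt0n.
apply/matrixP => k l; rewrite [LHS]mxE [RHS]mxE.
rewrite (eq_bigr (fun j => bloch lam (phi k) 0 j * bloch lam (phi l) 0 j)); last first.
  by move=> j _; rewrite !mxE.
have [<-|kl] := eqVneq k l.
  rewrite (bloch_dot _ _ _ _ _ 1) ?phi1 ?normr1 ?rmorph1 //.
  by rewrite expr1n mulr1 mulr1n.
rewrite (bloch_dot _ _ _ _ _ _ d0 basis _ _ (phi_mub k l kl)) ?phi1 //.
by rewrite expr_div_n expr1n sqr_sqrtr ?ler0n // mul1r divff // subrr mulr0n.
Qed.

(** * Correlation matrix and weights of the mixture *)

Lemma correlation_mixture (R : realType) (d m : nat)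
    (lam : 'I_(d ^ 2).-1.+1 -> 'M[R[i]]_d) (phi : 'I_m -> 'cV[R[i]]_d)
    (w : 'rV[R]_m) : operator_basis lam ->
  let V := \matrix_k bloch lam (phi k) in
  correlation_matrix lam
    (\sum_k (w 0 k)%:C *: mxtens.tensmx (ketbra (phi k)) (ketbra (phi k))) =
  V^T *m diag_mx w *m V.
Proof.
move=> basis V; apply/matrixP => i j; rewrite mxE.
suff -> : \tr ((\sum_k (w 0 k)%:C *: mxtens.tensmx (ketbra (phi k)) (ketbra (phi k)))
    *m mxtens.tensmx (lam (lift ord0 i)) (lam (lift ord0 j))) =
    ((V^T *m diag_mx w *m V) i j)%:C by [].
rewrite mulmx_suml mul_mx_diag mxE rmorph_sum (raddf_sum (@mxtrace _ _)).
apply: eq_bigr => k _.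
rewrite -scalemxAl; apply: etrans; first exact: mxtraceZ.
rewrite mxtens.tensmx_mul mxtrace_tens -!blochE //.
by rewrite !mxE -!rmorphM; congr (_%:C); ring.
Qed.

(** Slot [ord0] belongs to [psi'] and the N others to the [psi i], matching [unlift ord0] in
    [rho_mixE]. *)
Definition weights (R : realType) (N : nat) (p : R) : 'rV[R]_N.+1 :=
  \row_k (if k == ord0 then 1 - p else p / N%:R).

Lemma rho_mixE (R : realType) (d N : nat) (psi : 'I_N -> 'cV[R[i]]_d)
    (psi' : 'cV[R[i]]_d) (p : R) :
  let phi k := oapp psi psi' (unlift ord0 k) in
  rho_mix psi psi' p = \sum_(k < N.+1)
    (weights R N p 0 k)%:C *:
      mxtens.tensmx (ketbra (phi k)) (ketbra (phi k)).
Proof.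
move=> phi; rewrite big_ord_recl /phi /= mxE eqxx unlift_none addrC /rho_mix.
by rewrite scaler_sumr; congr (_ + _); apply: eq_bigr => k _; rewrite mxE liftK.
Qed.

Lemma sum_weights (R : realType) N (p : R) m :
  \sum_k weights R N p 0 k ^+ m = N%:R * (p / N%:R) ^+ m + (1 - p) ^+ m.
Proof.
rewrite big_ord_recl /= mxE eqxx addrC; congr (_ + _).
rewrite (eq_bigr (fun=> (p / N%:R) ^+ m)) => [|i _]; last by rewrite mxE.
by rewrite sumr_const card_ord mulr_natl.
Qed.

(** N < n leaves room for b after the N copies of a; m > 0 removes the padding zeros, since 0 ^+ 0 =
    1. *)
Lemma sum_block (R : pzRingType) N n (a b : R) m : (N < n)%N -> (0 < m)%N ->
  \sum_(i < n) (if (i < N)%N then a else if i == N :> nat then b else 0) ^+ m =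
  N%:R * a ^+ m + b ^+ m.
Proof.
move=> Nn m0.
rewrite (bigID (fun i : 'I_n => i < N)%N) /=; congr (_ + _).
  rewrite (eq_bigr (fun=> a ^+ m)) => [|i ->//].
  by rewrite (big_ord_narrow (ltnW Nn)) sumr_const card_ord mulr_natl.
rewrite (bigD1 (Ordinal Nn)) /= ?ltnn //= eqxx big1 ?addr0 // => i.
move=> /andP[/negbTE-> /negbTE]; rewrite -val_eqE /= => ->.
by rewrite expr0n gtn_eqF.
Qed.

(** * The lower boundary along the family *)

(** As [f_lb] is defined as a minimum, the value y is shown to be attained on the feasible set
    ([ub]) and to bound it from below ([lb]). *)
Lemma f_lb_mix (R : realType) (d N : nat) (p : R) :
  (2 <= d)%N -> (1 <= N)%N -> (N < (d ^ 2).-1)%N -> N%:R / N.+1%:R <= p <= 1 ->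
  f_lb d (N%:R * (p / N%:R) ^+ 2 + (1 - p) ^+ 2) =
  (2 * (N%:R * (p / N%:R) ^+ 4 + (1 - p) ^+ 4)
   + (N%:R * (p / N%:R) ^+ 2 + (1 - p) ^+ 2) ^+ 2) / 3.
Proof.
move=> d2 N1 Nn /andP[pge ple].
have c0 : 0 < d%:R - 1 :> R by rewrite subr_gt0 ltr1n.
have N0 : 0 < N%:R :> R by rewrite ltr0n.
have N10 : 0 < N.+1%:R :> R by rewrite ltr0n.
set a := p / N%:R; set b := 1 - p; set c : R := d%:R - 1.
have b0 : 0 <= b by rewrite subr_ge0.
(* The left end N / (N + 1) of the interval enters here: it is the p with 1 - p = p / N. *)
have ba : b <= a.
  rewrite /a ler_pdivlMr // /b.
  by move: pge; rewrite ler_pdivrMr // -natr1; lra.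
have Nab : N%:R * a + b = 1 by rewrite /a /b mulrC divfK ?gt_eqF //; ring.
have a0 : 0 <= a := le_trans b0 ba.
have cw := ltW c0.
set x := N%:R * a ^+ 2 + b ^+ 2; set y := RHS.
(* The spectrum of the mixture itself, padded with zeros; its sum c (N a + b) = c saturates the
   trace norm bound. *)
pose s : 'rV[R]_((d ^ 2).-1) :=
  \row_i if (i < N)%N then c * a else if i == N :> nat then c * b else 0.
have sE m : (0 < m)%N -> \sum_i s 0 i ^+ m = c ^+ m * (N%:R * a ^+ m + b ^+ m).
  move=> m0; under eq_bigr do rewrite mxE.
  by rewrite sum_block // !exprMn; ring.
have ub : feasible_moment4 d x y.
  exists s; last first.
    rewrite (moments_diag _ _ s).2 !sE // /y -/x -/c.
    by field; rewrite gt_eqF.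
  split.
  - by move=> i; rewrite mxE; do 2 ?case: ifP => _ //; rewrite mulr_ge0.
  - rewrite -/c; have := sE 1%N isT; rewrite !expr1 Nab mulr1 => <-.
    by under [leRHS]eq_bigr do rewrite expr1.
  - rewrite (moments_diag _ _ s).1 sE // -/x -/c; field.
    by rewrite gt_eqF.
have lb : lbound (feasible_moment4 d x) y.
  move=> _ [t [t0 t1 t2] <-].
  move: t2; rewrite (moments_diag _ _ t).1 (moments_diag _ _ t).2 -/c => t2.
  have {}t2 : \sum_i t 0 i ^+ 2 = N%:R * (c * a) ^+ 2 + (c * b) ^+ 2.
    rewrite -[LHS](divfK (expf_neq0 2 (lt0r_neq0 c0))) t2 /x -/c; ring.
  have {t1}t1 : \sum_i t 0 i <= N%:R * (c * a) + c * b.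
    have -> : N%:R * (c * a) + c * b = c * (N%:R * a + b) by ring.
    by rewrite Nab mulr1.
  have cab : 0 <= c * b <= c * a by rewrite mulr_ge0 //= ler_pM2l.
  have := sum_quartic_ge _ _ _ _ _ _ cab t0 t1 t2.
  (* The square sum is fixed, so only the quartic sums remain to be compared. *)
  rewrite t2 ler_pdivlMr ?mulr_gt0 ?exprn_gt0 // => h.
  have -> : y * (3 * c ^+ 4) = 2 * (N%:R * (c * a) ^+ 4 + (c * b) ^+ 4) +
      (N%:R * (c * a) ^+ 2 + (c * b) ^+ 2) ^+ 2 by rewrite /y /x; field.
  by rewrite lerD2r ler_pM2l.
(* A minimum is unique, and y being one excludes the default value 0. *)
rewrite /f_lb; case: xgetP => [z _ [zf zlb]|/(_ y)]; last by case; split.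
by apply/eqP; rewrite eq_le zlb // lb.
Qed.

(** * Moments of the mixture *)

Lemma moments_rho_mix (R : realType) (d N : nat) (p : R)
    (lam : 'I_(d ^ 2).-1.+1 -> 'M[R[i]]_d)
    (psi : 'I_N -> 'cV[R[i]]_d) (psi' : 'cV[R[i]]_d) :
  (2 <= d)%N -> operator_basis lam ->
  (forall i, inner (psi i) (psi i) = 1) -> inner psi' psi' = 1 ->
  (forall i j, i != j -> `|inner (psi i) (psi j)| = (1 / Num.sqrt d%:R)%:C) ->
  (forall i, `|inner (psi i) psi'| = (1 / Num.sqrt d%:R)%:C) ->
  let T := correlation_matrix lam (rho_mix psi psi' p) in
  let x := N%:R * (p / N%:R) ^+ 2 + (1 - p) ^+ 2 in
  [/\ (N < (d ^ 2).-1)%N, moment2 T = x &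
      moment4 T = (2 * (N%:R * (p / N%:R) ^+ 4 + (1 - p) ^+ 4) + x ^+ 2) / 3].
Proof.
move=> d2 basis psi1 psi'1 psi_mub psi'_mub T x.
have c0 : d%:R - 1 != 0 :> R by rewrite subr_eq0 pnatr_eq1 gtn_eqF.
pose phi (k : 'I_N.+1) := oapp psi psi' (unlift ord0 k).
have phi1 k : inner (phi k) (phi k) = 1.
  by rewrite /phi; case: unliftP => [j _|_] /=.
have phi_mub k l : k != l -> `|inner (phi k) (phi l)| = (1 / Num.sqrt d%:R)%:C.
  rewrite /phi; case: unliftP => [i ->|->]; case: unliftP => [j ->|->] //=.
  - by rewrite (inj_eq lift_inj); exact: psi_mub.
  - by move=> _; rewrite inner_conj norm_conjC psi'_mub.
have gram := bloch_gram _ _ _ _ _ (ltnW d2) basis phi1 phi_mub.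
split.
(* The Gram identity gives a right inverse of the matrix of Bloch vectors, which has N + 1 rows and
   d^2 - 1 columns; hence N + 1 <= d^2 - 1. *)
- apply: (@mulmx1_min _ _ _ (\matrix_k bloch lam (phi k))
    ((d%:R - 1)^-1 *: (\matrix_k bloch lam (phi k))^T)).
  by rewrite -scalemxAr gram scale_scalar_mx mulVf.
- rewrite /T rho_mixE correlation_mixture //.
  rewrite (moments_gram _ _ _ _ _ _ gram).1 sum_weights -/x.
  by rewrite mulrAC divff ?mul1r // expf_neq0.
- rewrite /T rho_mixE correlation_mixture //.
  rewrite (moments_gram _ _ _ _ _ _ gram).2 !sum_weights -/x.
  by rewrite [3 * _]mulrC -mulf_div divff ?mul1r // expf_neq0.
Qed.

(** * Range of the second moment along the family *)

Lemma mix_purity_range (R : realFieldType) (N : nat) (p : R) : (1 <= N)%N ->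
  N%:R / N.+1%:R <= p <= 1 ->
  1 / N.+1%:R <= N%:R * (p / N%:R) ^+ 2 + (1 - p) ^+ 2 <= 1 / N%:R.
Proof.
move=> N1 /andP[pge ple].
have N0 : 1 <= N%:R :> R by rewrite ler1n.
have N10 : 0 < N%:R + 1 :> R by rewrite ltr_wpDl.
have {}pge : N%:R <= p * (N%:R + 1) by rewrite -ler_pdivrMr // natr1.
have -> : N%:R * (p / N%:R) ^+ 2 + (1 - p) ^+ 2 =
    (p ^+ 2 + N%:R * (1 - p) ^+ 2) / N%:R by field; lra.
apply/andP; split.
  rewrite -natr1 ler_pdivrMr // mulrAC ler_pdivlMr ?mul1r; last lra.
  (* This square equals (N + 1) (p^2 + N (1 - p)^2) - N. *)
  have := sqr_ge0 (p * (N%:R + 1) - N%:R); lra.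
rewrite ler_pM2r ?invr_gt0; last lra.
(* The product equals 1 - p^2 - N (1 - p)^2. *)
have : 0 <= (1 - p) * (p * (N%:R + 1) - N%:R + 1) by rewrite mulr_ge0; lra.
lra.
Qed.

Lemma mix_purity_onto (R : rcfType) (N : nat) (x : R) : (1 <= N)%N ->
  1 / N.+1%:R <= x <= 1 / N%:R ->
  exists2 p, N%:R / N.+1%:R <= p <= 1 &
    N%:R * (p / N%:R) ^+ 2 + (1 - p) ^+ 2 = x.
Proof.
move=> N1 /andP[xge xle].
have N0 : 0 < N%:R :> R by rewrite ltr0n.
have N10 : 0 < N%:R + 1 :> R by rewrite ltr_wpDl // ltW.
have {}xge : 1 <= x * (N%:R + 1) by rewrite -ler_pdivrMr // natr1.
have {}xle : x * N%:R <= 1 by rewrite -ler_pdivlMr.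
(* The equation for p reads (p (N + 1) - N)^2 = v, with v as in the closed formula of the boundary
   at K = N; the larger root is taken. *)
pose v := N%:R * (x * (N%:R + 1) - 1); pose t := Num.sqrt v.
have v0 : 0 <= v by rewrite mulr_ge0 ?subr_ge0 // ltW.
have t0 : 0 <= t by rewrite sqrtr_ge0.
have t2 : t ^+ 2 = v by rewrite sqr_sqrtr.
have t1 : t <= 1.
  rewrite -(@ler_pXn2r _ 2) ?nnegrE // t2 expr1n /v.
  have : x * N%:R * (N%:R + 1) <= N%:R + 1 by rewrite ger_pMl.
  lra.
exists ((N%:R + t) / (N%:R + 1)).
  by rewrite -natr1 ler_pM2r ?invr_gt0 // lerDl t0 ler_pdivrMr // mul1r lerD2l.
have -> : N%:R * ((N%:R + t) / (N%:R + 1) / N%:R) ^+ 2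
    + (1 - (N%:R + t) / (N%:R + 1)) ^+ 2 = (N%:R + t ^+ 2) / (N%:R * (N%:R + 1)).
  by field; rewrite !gt_eqF.
by rewrite t2 /v; field; rewrite !gt_eqF.
Qed.

(** * The family as the graph of [f_lb] *)

Theorem corollary4 (R : realType) (d N : nat) (hd : (2 <= d)%N) (hN : (1 <= N)%N)
    (lam : 'I_(d ^ 2).-1.+1 -> 'M[R[i]]_d) (hlam : operator_basis lam)
    (psi : 'I_N -> 'cV[R[i]]_d) (psi' : 'cV[R[i]]_d)
    (hpsi : forall i, inner (psi i) (psi i) = 1)
    (hpsi' : inner psi' psi' = 1)
    (hij : forall i j, i != j ->
       `|inner (psi i) (psi j)| = (1 / Num.sqrt d%:R)%:C)
    (hi : forall i, `|inner (psi i) psi'| = (1 / Num.sqrt d%:R)%:C) :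
  let R2 p := moment2 (correlation_matrix lam (rho_mix psi psi' p)) in
  let R4 p := moment4 (correlation_matrix lam (rho_mix psi psi' p)) in
  [/\ R2 (N%:R / N.+1%:R) = 1 / N.+1%:R,
      R2 1 = 1 / N%:R &
      [set (R2 p, R4 p) | p in [set p : R | N%:R / N.+1%:R <= p <= 1]] =
      [set (x, f_lb d x) | x in [set x : R | 1 / N.+1%:R <= x <= 1 / N%:R]]].
Proof.
move=> R2 R4.
have RE p := moments_rho_mix R d N p lam psi psi' hd hlam hpsi hpsi' hij hi.
have N0 : N%:R != 0 :> R by rewrite pnatr_eq0 -lt0n.
have N10 : N%:R + 1 != 0 :> R by rewrite natr1 pnatr_eq0.
(* The dimension bound does not involve p; the instance p = 0 supplies it. *)
have [Nd _ _] := RE 0.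
have R4E p : N%:R / N.+1%:R <= p <= 1 -> R4 p = f_lb d (R2 p).
  by move=> hp; have [_ e2 e4] := RE p; rewrite /R4 /R2 e4 e2 f_lb_mix.
split.
- by rewrite /R2; have [_ -> _] := RE (N%:R / N.+1%:R); rewrite -natr1; field; rewrite N0 N10.
- by rewrite /R2; have [_ -> _] := RE 1; field.
(* By [R4E] the family lies on the graph; what remains is that the second moment maps
   [N / (N + 1), 1] onto [1 / (N + 1), 1 / N]. *)
apply/seteqP; split=> [_ [p hp <-]|_ [x hx <-]].
  exists (R2 p); last by rewrite -R4E.
  by have [_ e2 _] := RE p; rewrite /R2 /= e2; exact: mix_purity_range.
have [p hp px] := mix_purity_onto _ _ _ hN hx.
have R2x : R2 p = x by have [_ e2 _] := RE p; rewrite /R2 e2.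
by exists p => //; rewrite R4E // R2x.
Qed.
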